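(* There is an infinite sequence of positive integers $x_1,x_2,x_3,\ldots$ (the Pulsar sequence) that is the concatenation of consecutive blocks $B_1,B_2,B_3,\ldots$, where the block $B_m=(a_1,\ldots,a_m)$ has length $m$, consists of the numbers $1,2,\ldots,m$ in some order, and satisfies $a_i+a_{m+1-i}=m+1$ for all $1\le i\le m$, with first blocks $$(1),\ (2,1),\ (3,2,1),\ (4,2,3,1),\ (5,2,3,4,1),\ (6,2,4,3,5,1),\ (7,2,5,4,3,6,1),$$ such that for every positive integer $n$ the following hold. (1) The $n\times n$ Pulsar puzzle has a unique solution. (2) In this solution the circled spiral is filled, starting from the center, with the dual of the Pulsar sequence: for $1\le k\le \frac{n(n+1)}{2}$, the $k$-th cell of the circled spiral counted from the center contains $(x_k)_n=n+1-x_k$. (3) In this solution the uncircled spiral is filled, starting from the center, with the Pulsar sequence: for $1\le k\le \frac{n(n-1)}{2}$, the $k$-th cell of the uncircled spiral counted from the center contains $x_k$. (4) In this solution, in each row and in each column, each number in a circled cell is greater than each number in an uncircled cell.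
   Context: Cells of an $n\times n$ grid are denoted $(r,c)$ with row $r$ and column $c$, $1\le r,c\le n$; row $1$ is the top row and column $1$ is the leftmost column. A Latin square of size $n$ is a filling of the $n\times n$ grid with numbers from $\{1,\ldots,n\}$ such that the entries of each row are distinct and the entries of each column are distinct. Circled spiral. The circled cells form a clockwise inward spiral made of $n$ straight pieces of sizes $n,n-1,\ldots,1$, for a total of $\frac{n(n+1)}{2}$ cells. The first piece is the first row, traversed from $(1,1)$ to $(1,n)$. The second piece consists of the $n-1$ cells $(2,n),\ldots,(n,n)$, traversed downward. The third consists of the $n-2$ cells $(n,n-1),\ldots,(n,2)$, traversed leftward. The fourth consists of the $n-3$ cells $(n-1,2),\ldots,(3,2)$, traversed upward, and so on: the directions cycle right, down, left, up; each new piece begins at the cell adjacent, in the new direction, to the last cell of the previous piece; and the piece sizes decrease by one each time until the last piece, of size $1$. Uncircled spiral. The remaining $\frac{n(n-1)}{2}$ cells (the uncircled cells) also form a clockwise inward spiral, made of pieces of sizes $n-1,n-2,\ldots,1$. The first piece is $(n,1),(n-1,1),\ldots,(2,1)$, traversed upward. The second is the $n-2$ cells $(2,2),\ldots,(2,n-1)$, traversed rightward. The third is the $n-3$ cells $(3,n-1),\ldots,(n-1,n-1)$, traversed downward, and so on: the directions cycle up, right, down, left, with the same rule for where each piece begins. For $n=1$ this spiral is empty. ''Starting from the center'' means that the cells of a spiral are listed in the reverse of the inward order just described, so the first cell is the innermost one. For the circled spiral the last cell is $(1,1)$, and the last $n$ cells are the top row read from right to left. For the uncircled spiral the last cell is $(n,1)$,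 and the last $n-1$ cells are column $1$ read from row $2$ down to row $n$. The $n\times n$ Pulsar puzzle: a solution is a Latin square of size $n$ such that, whenever a number $d$ appears in some circled cell, the number of circled cells containing $d$ is exactly $d$. Dual: for $x\in\{1,\ldots,n\}$, $(x)_n=n+1-x$. *)

(* Defs.v *)
From mathcomp Require Import all_boot all_algebra.

Set Implicit Arguments.
Unset Strict Implicit.
Unset Printing Implicit Defensive.

(* Cells are pairs (row, column), numbered from 1, with row 1 at the top. *)
Definition cell := (nat * nat)%type.

Inductive direction := Right | Down | Left | Up.

Definition turn (d : direction) : direction :=
  match d with Right => Down | Down => Left | Left => Up | Up => Right end.

Definition step (d : direction) (p : cell) : cell :=
  match d with
  | Right => (p.1, p.2.+1)
  | Down => (p.1.+1, p.2)
  | Left => (p.1, p.2.-1)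
  | Up => (p.1.-1, p.2)
  end.

(* Pieces of sizes k, k-1, ..., 1, the first one in direction d; the cell p is
   the one preceding the spiral and does not belong to it. *)
Fixpoint spiral (k : nat) (d : direction) (p : cell) : seq cell :=
  if k is k'.+1 then
    let piece := traject (step d) (step d p) k in
    piece ++ spiral k' (turn d) (last p piece)
  else [::].

(* Both spirals are listed inwards; the cells (1, 0) and (n + 1, 1) preceding
   them lie outside the grid. *)
Definition circled_spiral (n : nat) : seq cell := spiral n Right (1, 0).
Definition uncircled_spiral (n : nat) : seq cell := spiral n.-1 Up (n.+1, 1).

(* A filling of the grid is a matrix, whose indices start from 0. *)
Definition cell_of n (i j : 'I_n) : cell := (i.+1, j.+1).

Definition circled n (i j : 'I_n) : bool := cell_of i j \in circled_spiral n.

Definition contains n (L : 'M[nat]_n) (p : cell) (v : nat) : Prop :=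
  exists i j : 'I_n, p = cell_of i j /\ L i j = v.

(* k >= 1; the default (0, 0) is not a cell of the grid. *)
Definition kth_from_center (s : seq cell) (k : nat) : cell :=
  nth (0, 0) (rev s) k.-1.

Definition latin_square n (L : 'M[nat]_n) : Prop :=
  [/\ forall i j, 1 <= L i j <= n,
      forall i, injective (fun j => L i j)
    & forall j, injective (fun i => L i j)].

Definition pulsar_solution n (L : 'M[nat]_n) : Prop :=
  latin_square L /\
  forall d : nat,
    (exists i j : 'I_n, circled i j /\ L i j = d) ->
    #|[set p : 'I_n * 'I_n | circled p.1 p.2 && (L p.1 p.2 == d)]| = d.

Definition dual (n x : nat) : nat := n.+1 - x.

(* A sequence x_1, x_2, ... is a function on nat whose value at 0 is ignored.
   For 1 <= i <= m, the i-th entry of the m-th block is preceded by the blocks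
   of lengths 1, ..., m - 1. *)
Definition block_entry (x : nat -> nat) (m i : nat) : nat :=
  x (\sum_(1 <= l < m) l + i).

Definition block (x : nat -> nat) (m : nat) : seq nat :=
  [seq block_entry x m i | i <- iota 1 m].

Definition pulsar_blocks (x : nat -> nat) : Prop :=
  (forall m, 0 < m ->
     perm_eq (block x m) (iota 1 m) /\
     forall i, 1 <= i <= m ->
       block_entry x m i + block_entry x m (m.+1 - i) = m.+1) /\
  [seq block x m | m <- iota 1 7] =
    [:: [:: 1];
        [:: 2; 1];
        [:: 3; 2; 1];
        [:: 4; 2; 3; 1];
        [:: 5; 2; 3; 4; 1];
        [:: 6; 2; 4; 3; 5; 1];
        [:: 7; 2; 5; 4; 3; 6; 1]].

(* Main.v *)
(* Write w = n + 1 - L for the dual of a solution L.  Row i has r_i circled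
   cells, and (r_i) is a permutation of 1, ..., n; the same holds for columns.
   Since there are 1 + ... + n circled cells, every d occurs in exactly d of
   them, so the sum of w over the circled cells is that of (n + 1 - d) d.  In
   row i this sum is at least 1 + ... + r_i, and adding up these bounds gives
   equality: in each row and each column the circled cells carry the smallest
   values of w.

   The circled cells and the uncircled cells thus give two independent copies
   of the same problem: fill a spiral so that the values are distinct in every
   line and at most the number of cells of that line.  The outermost piece meets
   all the perpendicular lines, and their cell counts are a permutation of
   1, ..., k; so each of its cells must contain the cell count of the
   perpendicular line through it.  Removing the outermost piece leaves the same
   problem for the rest of the spiral. *)

Require Import Defs.
From mathcomp Require Import all_boot all_algebra.
From mathcomp Require Import zify.

Set Implicit Arguments.
Unset Strict Implicit.
Unset Printing Implicit Defensive.

(** * Spirals in normalized coordinates *)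

(* A spiral is described in coordinates (u, v): u is the position along the
   first piece and v is the depth below it, both counted from 0.  [turn_cell k]
   embeds the spiral of k pieces that follows a first piece of k + 1 cells. *)
Definition turn_cell (k : nat) (p : nat * nat) : nat * nat := (k - p.2, p.1.+1).

Fixpoint cells (k : nat) : seq (nat * nat) :=
  if k is k'.+1 then
    [seq (u, 0) | u <- iota 0 k] ++ [seq turn_cell k' p | p <- cells k']
  else [::].

Lemma cells_bound k u v : (u, v) \in cells k -> u < k /\ v < k.
Proof.
elim: k u v => [|k IHk] u v; first by [].
rewrite /cells -/cells mem_cat => /orP[/mapP[a]|/mapP[[a b] /IHk[]]].
  by rewrite mem_iota => ? [-> ->]; lia.
by rewrite /turn_cell /= => ? ? [-> ->]; lia.
Qed.

Lemma mem_cells0 k u : ((u, 0) \in cells k.+1) = (u <= k).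
Proof.
rewrite /cells -/cells mem_cat; apply/idP/idP.
  by case/orP=> /mapP[a]; rewrite ?mem_iota => ? [] // ->; lia.
by move=> le_uk; apply/orP; left; apply/mapP; exists u; rewrite ?mem_iota.
Qed.

Lemma mem_cellsS k u v :
  ((u, v.+1) \in cells k.+1) = (u <= k) && ((v, k - u) \in cells k).
Proof.
rewrite /cells -/cells mem_cat; apply/idP/idP.
  case/orP=> [/mapP[? _ []]|/mapP[[a b]]] //.
  rewrite /turn_cell /= => ab [-> ->].
  have [_ lt_bk] := cells_bound ab.
  by rewrite leq_subr subKn // ltnW.
case/andP=> le_uk vu; apply/orP; right; apply/mapP; exists (v, k - u) => //.
by rewrite /turn_cell /= subKn.
Qed.

Lemma uniq_cells k : uniq (cells k).
Proof.
elim: k => // k IHk; rewrite /cells -/cells cat_uniq; apply/and3P; split.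
- by rewrite map_inj_uniq ?iota_uniq // => a b [].
- by apply/hasPn=> _ /mapP[[a b] _ ->]; apply/mapP => -[].
rewrite map_inj_in_uniq // => -[a b] [c d] /cells_bound[? ?] /cells_bound[? ?].
by rewrite /turn_cell /= => -[] ? ->; congr (_, _); lia.
Qed.

Lemma size_cells k : size (cells k) = \sum_(d < k.+1) d.
Proof.
elim: k => [|k IHk]; first by rewrite big_ord_recr big_ord0.
rewrite /cells -/cells size_cat !size_map size_iota IHk.
by rewrite [RHS]big_ord_recr addnC.
Qed.

(** * Cell counts of the lines of a spiral *)

(* The numbers of cells in the lines perpendicular and parallel to the first
   piece. *)
Definition across (k u : nat) : nat := count (fun p => p.1 == u) (cells k).
Definition along (k v : nat) : nat := count (fun p => p.2 == v) (cells k).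

Lemma along0 k : along k 0 = k.
Proof.
case: k => // k; rewrite /along /cells -/cells count_cat !count_map.
rewrite (eq_count (a2 := predT)) // count_predT size_iota.
by rewrite (eq_count (a2 := pred0)) // count_pred0 addn0.
Qed.

Lemma alongS k v : along k.+1 v.+1 = across k v.
Proof.
rewrite /along /cells -/cells count_cat !count_map.
by rewrite (eq_count (a2 := pred0)) // count_pred0.
Qed.

Lemma along_ge k v : k <= v -> along k v = 0.
Proof.
move=> le_kv; apply/eqP; rewrite -leqn0 leqNgt -has_count -all_predC.
by apply/allP=> -[a b] /cells_bound[? ?] /=; lia.
Qed.

(** The line [u] meets the first piece once; through [turn_cell] its other cells form the line of
    depth [k - u] of the inner spiral. *)
Lemma acrossS k u : u <= k -> across k.+1 u = (along k (k - u)).+1.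
Proof.
move=> le_uk; rewrite /across /cells -/cells count_cat !count_map.
rewrite (eq_count (a2 := pred1 u)) // count_uniq_mem ?iota_uniq //.
rewrite mem_iota ltnS le_uk add1n; congr _.+1; apply: eq_in_count.
by move=> -[a b] /cells_bound[? ?] /=; apply/eqP/eqP; lia.
Qed.

Lemma across0 k : across k.+1 0 = 1.
Proof. by rewrite acrossS // subn0 along_ge. Qed.

Lemma across_last k : across k.+1 k = k.+1.
Proof. by rewrite acrossS // subnn along0. Qed.

Lemma across_mid k u : u < k -> across k.+2 u.+1 = (across k (k.-1 - u)).+1.
Proof.
move=> lt_uk; rewrite acrossS; last by lia.
by rewrite (_ : k.+1 - u.+1 = (k.-1 - u).+1) ?alongS //; lia.
Qed.

(** This symmetry becomes that of the Pulsar blocks. The end lines have 1 and [k] cells; by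
    [across_mid], stripping two pieces reflects the inner lines and lowers each count by one. *)
Lemma across_dual k u : u < k -> across k u + across k (k.-1 - u) = k.+1.
Proof.
elim/ltn_ind: k u => -[|[|k]] IHk [|u] //= lt_uk.
  by rewrite subn0 across0 across_last.
have [->|lt_uk'] : u = k \/ u < k by lia.
  by rewrite subnn across0 across_last addn1.
rewrite (_ : k.+1 - u.+1 = (k.-1 - u).+1); last by lia.
rewrite !across_mid; try lia.
by rewrite addnS addSn IHk //; lia.
Qed.

Lemma across_bound k u : u < k -> 0 < across k u <= k.
Proof.
case: k => // k lt_uk; have := across_dual lt_uk.
by rewrite /= !acrossS; lia.
Qed.

(** The end lines have the extreme counts 1 and [k], the inner ones lie strictly between by
    [across_mid], so induction descends by two. *)
Lemma across_inj k u u' :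
  u < k -> u' < k -> across k u = across k u' -> u = u'.
Proof.
elim/ltn_ind: k u u' => -[|[|k]] IHk [|u] [|u'] //= ltu ltu'.
- rewrite across0 acrossS //; have [->|ne] := eqVneq u' k.
    by rewrite subnn along0.
  rewrite (_ : k.+1 - u'.+1 = (k.-1 - u').+1) ?alongS; last by lia.
  by have := @across_bound k (k.-1 - u'); lia.
- rewrite across0 acrossS //; have [->|ne] := eqVneq u k.
    by rewrite subnn along0.
  rewrite (_ : k.+1 - u.+1 = (k.-1 - u).+1) ?alongS; last by lia.
  by have := @across_bound k (k.-1 - u); lia.
have [->|neu] := eqVneq u k; have [->|neu'] := eqVneq u' k => //.
- rewrite across_last across_mid; last by lia.
  by have := @across_bound k (k.-1 - u'); lia.
- rewrite across_last across_mid; last by lia.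
  by have := @across_bound k (k.-1 - u); lia.
rewrite !across_mid; try lia; move=> [] /IHk; lia.
Qed.

Lemma perm_map_iota (T : eqType) (s : seq T) (c : T -> nat) :
    uniq s -> {in s, forall x, 0 < c x <= size s} -> {in s &, injective c} ->
  perm_eq (map c s) (iota 1 (size s)).
Proof.
move=> uniq_s c_bound c_inj.
have uniq_c : uniq (map c s) by rewrite map_inj_in_uniq.
have sub_c : {subset map c s <= iota 1 (size s)}.
  by move=> _ /mapP[x + ->]; rewrite mem_iota => /c_bound; lia.
apply: uniq_perm; rewrite ?iota_uniq //.
by apply: (uniq_min_size uniq_c sub_c _).2; rewrite size_map size_iota.
Qed.

Lemma perm_iota_inj k (c : nat -> nat) :
    (forall u, u < k -> 0 < c u <= k) ->
    (forall u u', u < k -> u' < k -> c u = c u' -> u = u') ->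
  perm_eq [seq c u | u <- iota 0 k] (iota 1 k).
Proof.
move=> c_bound c_inj; rewrite -[k in iota 1 k](size_iota 0).
apply: perm_map_iota => [|u|u u']; first exact: iota_uniq.
  by rewrite mem_iota size_iota => /c_bound.
by rewrite !mem_iota => ltu ltu'; apply: c_inj.
Qed.

Lemma perm_across k : perm_eq [seq across k u | u <- iota 0 k] (iota 1 k).
Proof. exact/perm_iota_inj/across_inj/across_bound. Qed.

Lemma along_bound k v : v < k -> 0 < along k v <= k.
Proof.
case: k v => // k [|v] lt_vk; first by rewrite along0 leqnn.
by rewrite alongS; have := @across_bound k v; lia.
Qed.

Lemma along_inj k v v' : v < k -> v' < k -> along k v = along k v' -> v = v'.
Proof.
case: k v v' => // k [|v] [|v'] // ltv ltv'; rewrite ?along0 ?alongS.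
- by have := @across_bound k v'; lia.
- by have := @across_bound k v; lia.
by move/across_inj=> ->; lia.
Qed.

Lemma perm_along k : perm_eq [seq along k v | v <- iota 0 k] (iota 1 k).
Proof. exact/perm_iota_inj/along_inj/along_bound. Qed.

Lemma along_dual k v : v <= k -> along k v + along k (k - v) = k.
Proof.
case: k v => [|k] [|v] // le_vk; first by rewrite subn0 along0 along_ge ?addn0.
have [->|lt_vk] := eqVneq v k; first by rewrite subnn along0 along_ge ?addn0.
rewrite (_ : k.+1 - v.+1 = (k.-1 - v).+1) ?alongS; last by lia.
by apply: across_dual; lia.
Qed.

(** * The unique filling of a spiral *)

(** Each cell of a piece receives the cell count of the perpendicular line through it, taken in the
    spiral that starts with this piece. The recursive call undoes [turn_cell]. *)
Fixpoint value (k u v : nat) : nat :=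
  if k is k'.+1 then
    if v is v'.+1 then value k' v' (k' - u) else across k u
  else 0.

Definition values (k : nat) : seq nat := [seq value k p.1 p.2 | p <- cells k].

Lemma valuesS k :
  values k.+1 = [seq across k.+1 u | u <- iota 0 k.+1] ++ values k.
Proof.
rewrite /values /cells -/cells map_cat -!map_comp; congr (_ ++ _).
by apply/eq_in_map=> -[a b] /cells_bound[_ lt_bk] /=; rewrite subKn // ltnW.
Qed.

(** The constraints one spiral inherits from a solution: [f] will be the dual entries on the circled
    spiral and the entries themselves on the uncircled one. *)
Definition filling (k : nat) (f : nat -> nat -> nat) : Prop :=
  [/\ forall u v, (u, v) \in cells k ->
        [/\ 0 < f u v, f u v <= across k u & f u v <= along k v],
      forall u v v', (u, v) \in cells k -> (u, v') \in cells k ->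
        f u v = f u v' -> v = v'
    & forall u u' v, (u, v) \in cells k -> (u', v) \in cells k ->
        f u v = f u' v -> u = u'].

Lemma filling_value k : filling k (value k).
Proof.
elim: k => [|k [IHb IHu IHv]]; first by split.
(* An inner value is at most the inner count of its line, one less than [across k.+1 u], the value
   in the first piece; hence no repetition with that piece. *)
have below u v : (u, v.+1) \in cells k.+1 ->
    value k.+1 u v.+1 < across k.+1 u.
  rewrite mem_cellsS => /andP[le_uk /IHb[_ _]].
  by rewrite acrossS // ltnS.
split.
- move=> u [|v].
    rewrite mem_cells0 along0 => le_uk /=.
    by have := @across_bound k.+1 u; split; lia.
  move=> uv; have := below _ _ uv.
  move: uv; rewrite mem_cellsS alongS => /andP[le_uk /IHb[? ? _]] /=.
  by split; lia.
- move=> u [|v] [|v'] // uv uv'.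
  + by have := below _ _ uv'; rewrite /=; lia.
  + by have := below _ _ uv; rewrite /=; lia.
  move: uv uv'; rewrite !mem_cellsS /= => /andP[_ uv] /andP[_ uv'].
  by move/(IHv _ _ _ uv uv')->.
move=> u u' [|v].
  by rewrite !mem_cells0 /= => ? ?; apply: across_inj.
rewrite !mem_cellsS /= => /andP[? uv] /andP[? uv'] /(IHu _ _ _ uv uv').
by lia.
Qed.

(** Injectivity makes [f], like [c], a permutation of [1, ..., k], so both have the same sum and the
    pointwise bound leaves no slack. *)
Lemma inj_bounded_eq k (c f : nat -> nat) :
    perm_eq [seq c u | u <- iota 0 k] (iota 1 k) ->
    (forall u, u < k -> 0 < f u <= c u) ->
    (forall u u', u < k -> u' < k -> f u = f u' -> u = u') ->
  forall u, u < k -> f u = c u.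
Proof.
move=> perm_c f_bound f_inj u lt_uk.
have c_le v : v < k -> c v <= k.
  move=> lt_vk; have : c v \in iota 1 k.
    by rewrite -(perm_mem perm_c) map_f // mem_iota.
  by rewrite mem_iota; lia.
have perm_f : perm_eq [seq f u | u <- iota 0 k] (iota 1 k).
  apply: perm_iota_inj f_inj => v lt_vk.
  by have := f_bound v lt_vk; have := c_le v lt_vk; lia.
have sums : \sum_(v < k) f v = \sum_(v < k) c v.
  rewrite -!(big_mkord xpredT) /index_iota subn0.
  rewrite -(big_map f xpredT id) -(big_map c xpredT id).
  by rewrite (perm_big _ perm_f) (perm_big _ perm_c).
have le_fc (v : 'I_k) : true -> f v <= c v ?= iff (f v == c v).
  by move=> _; split=> //; have /andP[] := f_bound v (ltn_ord v).
have := (leqif_sum le_fc).2; rewrite sums eqxx => /esym/forallP.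
by move/(_ (Ordinal lt_uk))/eqP.
Qed.

Lemma filling_uniq k f :
  filling k f -> forall u v, (u, v) \in cells k -> f u v = value k u v.
Proof.
elim: k f => // k IHk f [f_b f_u f_v].
have top u : u <= k -> f u 0 = across k.+1 u.
  rewrite -ltnS; move: u; apply: inj_bounded_eq (perm_across _) _ _ => u.
  - by move=> ltu; have [|-> -> //] := f_b u 0; rewrite mem_cells0.
  - by move=> u' ltu ltu'; apply: f_v; rewrite mem_cells0.
move=> u [|v]; first by rewrite mem_cells0 => /top.
rewrite mem_cellsS => /andP[le_uk uv] /=.
pose f' a b := f (k - b) a.+1.
have mem' a b : (a, b) \in cells k -> (k - b, a.+1) \in cells k.+1.
  move=> ab; have [_ lt_bk] := cells_bound ab.
  by rewrite mem_cellsS leq_subr subKn // ltnW.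
rewrite -(IHk f') ?/f' ?subKn //; split=> [a b ab|a b b' ab ab'|a a' b ab ab'].
- have [lt_ak lt_bk] := cells_bound ab.
  have [f_gt0 f_across f_along] := f_b _ _ (mem' _ _ ab).
  move: f_along; rewrite alongS => ->; split=> //.
  (* The first piece already carries the full count of this line, so the value below it is smaller
     by at least one: the bound for the inner spiral. *)
  have: f (k - b) a.+1 != f (k - b) 0.
    by apply/eqP=> /f_u; rewrite mem' // mem_cells0 leq_subr => /(_ isT isT).
  move: f_across; rewrite top ?leq_subr // acrossS ?leq_subr //.
  by rewrite subKn; lia.
- move/(f_v _ _ _ (mem' _ _ ab) (mem' _ _ ab')).
  by have [? ?] := cells_bound ab; have [? ?] := cells_bound ab'; lia.
by move/(f_u _ _ _ (mem' _ _ ab) (mem' _ _ ab'))=> [].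
Qed.

(** * The two spirals inside the grid *)

(** The coordinate [q.1] runs in direction [d] and [q.2] in direction [turn d]; the extra step is
    there because [p] precedes the spiral. *)
Definition place (d : direction) (p : cell) (q : nat * nat) : cell :=
  match d with
  | Right => (p.1 + q.2, (p.2 + q.1).+1)
  | Down => ((p.1 + q.1).+1, p.2 - q.2)
  | Left => (p.1 - q.2, (p.2 - q.1).-1)
  | Up => ((p.1 - q.1).-1, p.2 + q.2)
  end.

(* What is needed to keep the truncated predecessors in [step] away from 0. *)
Definition room (k : nat) (d : direction) (p : cell) : bool :=
  match d with
  | Right => true
  | Down => k <= p.2.+1
  | Left => (k <= p.2) && (k <= p.1.+1)
  | Up => k <= p.1
  end.

Lemma traject_place d p k :
  traject (step d) (step d p) k = [seq place d p (u, 0) | u <- iota 0 k].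
Proof.
have placeS u : step d (place d p (u, 0)) = place d p (u.+1, 0).
  by case: (d); rewrite /step /place /=; congr (_, _); lia.
have -> : step d p = place d p (0, 0).
  by case: (d); rewrite /step /place /=; congr (_, _); lia.
suff shifted u : traject (step d) (place d p (u, 0)) k =
    [seq place d p (u', 0) | u' <- iota u k] by [].
by elim: k u => //= k IHk u; rewrite placeS IHk.
Qed.

Lemma spiral_cells k d p :
  room k d p -> spiral k d p = [seq place d p q | q <- cells k].
Proof.
elim: k d p => // k IHk d p room_p.
rewrite /spiral -/spiral traject_place.
have -> : last p [seq place d p (u, 0) | u <- iota 0 k.+1] = place d p (k, 0).
  by rewrite -addn1 iotaD map_cat last_cat.
rewrite IHk; last by case: d room_p => /=; lia.
rewrite /cells -/cells map_cat -!map_comp; congr (_ ++ _).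
apply/eq_in_map=> -[u v] /cells_bound[lt_uk lt_vk].
by case: d room_p => /= room_p; congr (_, _); lia.
Qed.

(** Peeling a piece on the left and applying the induction hypothesis reaches the same cell as
    peeling a piece on the right. Thus the complement of a spiral is a spiral, up to a quarter
    turn. *)
Lemma notin_cells n a b : a < n -> b < n ->
  ((a, b) \notin cells n) = ((n.-1 - b, a) \in cells n.-1).
Proof.
elim: n a b => // n IHn a [|b]; rewrite ltnS => le_an lt_bn.
  rewrite mem_cells0 le_an; symmetry; apply/negbTE/negP=> /cells_bound[].
  by lia.
rewrite mem_cellsS le_an /=; case: n IHn le_an lt_bn => // n IHn.
case: a => [|a] le_an lt_bn.
  rewrite mem_cells0; apply/idP/idP=> _; first by lia.
  by apply/negP=> /cells_bound[]; lia.
rewrite IHn /=; try lia.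
rewrite mem_cellsS andb_idl => [|_]; last by lia.
by congr ((_, _) \in cells _); lia.
Qed.

Lemma card_count_cells (T : finType) (P : pred T) k (h : T -> nat * nat)
    (Q : pred (nat * nat)) :
    injective h -> (forall t, P t = (h t \in cells k) && Q (h t)) ->
    (forall q, q \in cells k -> Q q -> exists t, h t = q) ->
  #|[set t | P t]| = count Q (cells k).
Proof.
move=> h_inj PE h_onto; rewrite cardE -(size_map h) -size_filter.
apply/perm_size/uniq_perm=> [||q].
- by rewrite map_inj_uniq ?enum_uniq.
- by rewrite filter_uniq ?uniq_cells.
rewrite mem_filter; apply/mapP/andP=> [[t + ->]|[Qq q_in]].
  by rewrite mem_enum inE PE => /andP[-> ->].
have [t htq] := h_onto q q_in Qq; exists t => //.
by rewrite mem_enum inE PE htq q_in.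
Qed.

Lemma circledE n (i j : 'I_n) :
  circled i j = ((nat_of_ord j, nat_of_ord i) \in cells n).
Proof.
rewrite /circled /circled_spiral spiral_cells //.
apply/mapP/idP=> [[[u v] uv [ei ej]]|ij].
  by move: uv ei ej; rewrite /= add0n => uv -> ->.
by exists (nat_of_ord j, nat_of_ord i).
Qed.

Lemma uncircledE n (i j : 'I_n) :
  ~~ circled i j = ((n.-1 - i, nat_of_ord j) \in cells n.-1).
Proof. by rewrite circledE notin_cells. Qed.

Lemma card_circled_row n (i : 'I_n) : #|[set j | circled i j]| = along n i.
Proof.
apply: (card_count_cells (h := fun j : 'I_n => (nat_of_ord j, nat_of_ord i))).
- by move=> j j' [/val_inj].
- by move=> j; rewrite circledE eqxx andbT.
move=> [u v] /cells_bound[lt_un _] /= /eqP->.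
by exists (Ordinal lt_un).
Qed.

Lemma card_circled_col n (j : 'I_n) : #|[set i | circled i j]| = across n j.
Proof.
apply: (card_count_cells (h := fun i : 'I_n => (nat_of_ord j, nat_of_ord i))).
- by move=> i i' [/val_inj].
- by move=> i; rewrite circledE eqxx andbT.
move=> [u v] /cells_bound[_ lt_vn] /= /eqP->.
by exists (Ordinal lt_vn).
Qed.

Lemma card_circled n (Q : pred (nat * nat)) :
  #|[set p : 'I_n * 'I_n | circled p.1 p.2 && Q (val p.2, val p.1)]|
    = count Q (cells n).
Proof.
apply: (card_count_cells (h := fun p : 'I_n * 'I_n => (val p.2, val p.1))).
- by move=> [i j] [i' j'] [/val_inj -> /val_inj ->].
- by move=> p; rewrite circledE.
move=> [u v] /cells_bound[lt_un lt_vn] _.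
by exists (Ordinal lt_vn, Ordinal lt_un).
Qed.

(** * Double counting and dominance *)

Lemma perm_ord_inj n (c : 'I_n -> nat) :
    (forall i, 0 < c i <= n) -> injective c ->
  perm_eq [seq c i | i <- enum 'I_n] (iota 1 n).
Proof.
move=> c_bound c_inj; rewrite -[n in iota 1 n]size_enum_ord.
apply: perm_map_iota => [|i|i i' _ _]; [exact: enum_uniq | | exact: c_inj].
by rewrite size_enum_ord.
Qed.

Lemma sum_perm_ord n (c : 'I_n -> nat) (F : nat -> nat) :
  perm_eq [seq c i | i <- enum 'I_n] (iota 1 n) ->
  \sum_i F (c i) = \sum_(1 <= d < n.+1) F d.
Proof.
move=> perm_c; rewrite -[LHS]big_enum -(big_map c xpredT F) (perm_big _ perm_c).
by rewrite /index_iota subn1.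
Qed.

Lemma add_triangular n : 'C(n.+1, 2) + 'C(n, 2) = n * n.
Proof. by elim: n => // n; rewrite (binS n.+1 1) bin1 (binS n 1) bin1; nia. Qed.

(** The identity that makes the dominance bound tight. Passing from [n] to [n.+1] adds two
    consecutive triangular numbers on the left, which make the new square by [add_triangular]. *)
Lemma sum_dual_squares n :
  \sum_(1 <= d < n.+1) (n.+1 - d) * d + \sum_(1 <= d < n.+1) 'C(d, 2) =
  \sum_(1 <= d < n.+1) d * d.
Proof.
elim: n => [|n IHn]; first by rewrite !big_geq.
have recr F : \sum_(1 <= d < n.+2) F d = \sum_(1 <= d < n.+1) F d + F n.+1.
  by rewrite big_nat_recr.
have gauss : \sum_(1 <= d < n.+2) d = 'C(n.+2, 2).
  by rewrite -bin2_sum [RHS]big_ltn.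
have -> : \sum_(1 <= d < n.+2) (n.+2 - d) * d =
    \sum_(1 <= d < n.+1) (n.+1 - d) * d + \sum_(1 <= d < n.+2) d.
  rewrite !recr addnA -big_split subSnn mul1n; congr (_ + _).
  by apply: eq_big_nat => d /andP[_ lt_dn] /=; nia.
rewrite gauss recr [in RHS]recr -IHn -add_triangular.
exact: addnACA.
Qed.

(* Compare sum max(w, r) >= sum r^2 over the cells of c with
   sum w + sum (r - w), where the truncated differences r - w add up to at most
   'C(r, 2) in each row. *)
Lemma row_dominance n (c : rel 'I_n) (w : 'I_n -> 'I_n -> nat)
    (r : 'I_n -> nat) :
    (forall i j, 0 < w i j <= n) -> (forall i, injective (w i)) ->
    (forall i, #|[set j | c i j]| = r i) ->
    perm_eq [seq r i | i <- enum 'I_n] (iota 1 n) ->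
    \sum_i \sum_(j | c i j) w i j = \sum_(1 <= d < n.+1) (n.+1 - d) * d ->
  forall i j, (w i j <= r i) = c i j.
Proof.
move=> w_bound w_inj card_c perm_r sum_w.
have r_le i : r i <= n.
  have : r i \in iota 1 n by rewrite -(perm_mem perm_r) map_f ?mem_enum.
  by rewrite mem_iota; lia.
have le_max i j : r i <= maxn (w i j) (r i) ?= iff (w i j <= r i).
  by split; lia.
have row_sum i : \sum_(j | c i j) (r i - w i j) <= 'C(r i, 2).
  (* The whole row of [w] runs through [1, ..., n], so the differences over all its cells add up to
     [0 + ... + (r i - 1)]. *)
  have -> : 'C(r i, 2) = \sum_j (r i - w i j).
    rewrite (sum_perm_ord (subn (r i)) (perm_ord_inj (w_bound i) (@w_inj i))).
    rewrite (big_cat_nat (n := (r i).+1)) ?ltnS //= [X in _ + X]big_nat_cond.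
    rewrite [X in _ + X]big1 => [|d]; last by lia.
    rewrite addn0 big_nat_rev /= big_add1 /= -bin2_sum.
    by apply: eq_big_nat => d; lia.
  by rewrite [leqRHS](bigID (c i)) leq_addr.
have max_sum i : \sum_(j | c i j) maxn (w i j) (r i) <=
    \sum_(j | c i j) w i j + 'C(r i, 2).
  apply: leq_trans (leq_add (leqnn _) (row_sum i)); rewrite -big_split.
  by apply: leq_sum => j _ /=; lia.
have total : \sum_i \sum_(j | c i j) maxn (w i j) (r i) <=
    \sum_i \sum_(j | c i j) r i.
  apply: (leq_trans (n := \sum_i (\sum_(j | c i j) w i j + 'C(r i, 2)))).
    by apply: leq_sum => i _; apply: max_sum.
  rewrite big_split sum_w /= (sum_perm_ord (fun d => 'C(d, 2)) perm_r).
  rewrite sum_dual_squares -(sum_perm_ord (fun d => d * d) perm_r).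
  apply: leq_sum => i _; rewrite sum_nat_const -card_c.
  by rewrite cardsE.
(* Equality of the totals forces [maxn (w i j) (r i) = r i] in every cell of [c]. *)
have small i j : c i j -> w i j <= r i.
  move: i j.
  have := @leqif_sum _ xpredT _ _ _ (fun i _ =>
    @leqif_sum _ (c i) _ _ _ (fun j _ => le_max i j)).
  case=> le_tot eq_tot; move: eq_tot.
  have -> : (\sum_i \sum_(j | c i j) r i ==
      \sum_i \sum_(j | c i j) maxn (w i j) (r i)) by rewrite eqn_leq le_tot.
  by move/esym/forallP=> all_i i j cij; move/forall_inP: (all_i i); apply.
move=> i j; apply/idP/idP=> [le_wr|]; last exact: small.
apply/negPn/negP=> cij.
(* The cells of [c] in row [i] together with [j] would carry [r i + 1] distinct values in
   [1, ..., r i]. *)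
pose s := [seq w i j' | j' <- enum (j |: [set j' | c i j'])].
have : size s <= size (iota 1 (r i)).
  apply: uniq_leq_size => [|_ /mapP[j' + ->]].
    by rewrite map_inj_uniq ?enum_uniq.
  rewrite mem_enum !inE mem_iota => /orP[/eqP->|/small];
    by have := w_bound i j; have := w_bound i j'; lia.
by rewrite size_map -cardE cardsU1 inE cij card_c size_iota; lia.
Qed.

Lemma sum_circled n (L : 'M[nat]_n) (F : nat -> nat) :
    (forall i j, 0 < L i j <= n) ->
  \sum_(p | circled p.1 p.2) F (L p.1 p.2) = \sum_(d < n.+1)
    #|[set p : 'I_n * 'I_n | circled p.1 p.2 && (L p.1 p.2 == d)]| * F d.
Proof.
move=> L_bound.
rewrite (partition_big (fun p => inord (L p.1 p.2) : 'I_n.+1) xpredT) //=.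
apply: eq_bigr => d _; rewrite -sum1dep_card big_distrl /=.
have inordE p : (inord (L p.1 p.2) == d) = (L p.1 p.2 == d).
  have /andP[_ le_Ln] := L_bound p.1 p.2.
  by rewrite -val_eqE /= inordK.
apply: eq_big => [p|p]; first by rewrite inordE.
by rewrite inordE mul1n => /andP[_ /eqP->].
Qed.

(** An absent digit has count 0, so no count exceeds its digit; the counts add up to the number
    [0 + 1 + ... + n] of circled cells, so all of them are attained. *)
Lemma pulsar_count n (L : 'M[nat]_n) (d : nat) : pulsar_solution L -> d <= n ->
  #|[set p : 'I_n * 'I_n | circled p.1 p.2 && (L p.1 p.2 == d)]| = d.
Proof.
move=> [[L_bound _ _] L_count] le_dn.
pose m (d : 'I_n.+1) :=
  #|[set p : 'I_n * 'I_n | circled p.1 p.2 && (L p.1 p.2 == d)]|.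
have le_m (e : 'I_n.+1) : true -> m e <= e ?= iff (m e == e).
  move=> _; split=> //; have [|[[i j]]] := set_0Vmem
    [set p : 'I_n * 'I_n | circled p.1 p.2 && (L p.1 p.2 == e)].
    by rewrite /m => ->; rewrite cards0.
  by rewrite inE /= => /andP[cij /eqP Lij]; rewrite /m L_count //; exists i, j.
have sum_m : \sum_e m e = \sum_(e < n.+1) e.
  rewrite -size_cells -count_predT -(card_circled n predT).
  under eq_bigr do rewrite -[m _]muln1.
  rewrite -(sum_circled (fun => 1) L_bound) sum1dep_card.
  by apply: eq_card => p; rewrite !inE andbT.
have := (leqif_sum le_m).2; rewrite sum_m eqxx => /esym/forallP.
by move/(_ (Ordinal (le_dn : d < n.+1)))/eqP.
Qed.

(** * The Pulsar sequence *)

Lemma size_values k : size (values k) = \sum_(1 <= d < k.+1) d.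
Proof. by rewrite size_map size_cells -(big_mkord xpredT id) big_ltn. Qed.

Lemma leq_size_values k : k <= size (values k).
Proof.
by case: k => // k; rewrite valuesS size_cat size_map size_iota leq_addr.
Qed.

(** Read in the spiral of [k] pieces, which has at least [k] cells; by [nth_rev_values] every spiral
    long enough gives the same value. *)
Definition pulsar (k : nat) : nat := nth 0 (rev (values k)) k.-1.

(** Further pieces are wrapped around the outside by [valuesS], so the reversed list only grows at
    its end. *)
Lemma nth_rev_values n k :
  k < size (values n) -> nth 0 (rev (values n)) k = pulsar k.+1.
Proof.
have stable m d : k < size (values m) ->
    nth 0 (rev (values (d + m))) k = nth 0 (rev (values m)) k.
  move=> lt_k; elim: d => // d IHd.
  rewrite addSn valuesS rev_cat nth_cat size_rev IHd ifT //.
  apply: leq_trans lt_k _; elim: d {IHd} => // d /leq_trans-> //.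
  by rewrite addSn valuesS size_cat leq_addl.
move=> lt_k; have lt_kS := leq_size_values k.+1.
by rewrite /pulsar /= -(stable n k.+1) // addnC stable.
Qed.

(** The block is the outermost piece of the spiral of [m] pieces, read from its last cell; the
    spiral inside it supplies all earlier entries. *)
Lemma block_entry_pulsar m i :
  0 < i <= m -> block_entry pulsar m i = across m (m - i).
Proof.
case: m i => // [[]//|m] [|i] //= lt_im; rewrite /block_entry addnS.
rewrite -(@nth_rev_values m.+1); last first.
  by rewrite valuesS size_cat size_map size_iota size_values addnC ltn_add2r.
rewrite valuesS rev_cat nth_cat size_rev size_values.
rewrite ifF ?addKn; last by rewrite ltnNge leq_addr.
rewrite nth_rev size_map size_iota // (nth_map 0) ?size_iota ?nth_iota //; lia.
Qed.

Lemma blockE m : block pulsar m = [seq across m (m - i) | i <- iota 1 m].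
Proof.
apply/eq_in_map=> i; rewrite mem_iota add1n ltnS.
exact: block_entry_pulsar.
Qed.

Lemma pulsar_blocks_pulsar : pulsar_blocks pulsar.
Proof.
split=> [m m_gt0|]; last by rewrite (eq_map blockE).
split=> [|i im].
  rewrite blockE -[X in perm_eq _ (iota 1 X)](size_iota 1 m).
  apply: perm_map_iota => [|i|i j]; first exact: iota_uniq.
    by rewrite mem_iota size_iota => ?; apply: across_bound; lia.
  by rewrite !mem_iota => ? ? /across_inj; lia.
rewrite !block_entry_pulsar; try lia.
rewrite -[RHS](@across_dual m (m - i)); last by lia.
by congr (_ + across _ _); lia.
Qed.

(** Each piece carries a permutation of [1, ...] up to its size, so [w] occurs once in every piece
    of size at least [w]. For [w = n.+1 - d] this is the count [d] of the puzzle. *)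
Lemma count_values n w : 0 < w -> count_mem w (values n) = n.+1 - w.
Proof.
move=> w_gt0; elim: n => [|n IHn]; first by rewrite /values /=; lia.
rewrite valuesS count_cat IHn (permP (perm_across _)).
by rewrite count_uniq_mem ?iota_uniq // mem_iota; lia.
Qed.

(** * The explicit solution *)

(** Row [i] splits into uncircled and circled cells, each counted in the coordinates of its own
    spiral. *)
Lemma along_complement n i :
  i < n -> across n.-1 (n.-1 - i) + along n i = n.
Proof.
case: n => // n lt_in; rewrite -[RHS](@along_dual n.+1 i) 1?ltnW // addnC.
by rewrite subSn // alongS.
Qed.

Lemma across_complement n j : j < n -> along n.-1 j + across n j = n.
Proof.
by case: n => // n lt_jn; rewrite acrossS // addnS along_dual.
Qed.

(** The circled spiral starts along a row, so its coordinates are column and row; the uncircled one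
    starts up the first column from the bottom, hence [n.-1 - i]. *)
Definition grid_entry (n i j : nat) : nat :=
  if (j, i) \in cells n then n.+1 - value n j i else value n.-1 (n.-1 - i) j.

Definition grid (n : nat) : 'M[nat]_n := (\matrix_(i, j) grid_entry n i j)%R.

Lemma grid_circled n (i j : 'I_n) :
  circled i j -> grid n i j = n.+1 - value n j i.
Proof. by rewrite mxE /grid_entry circledE => ->. Qed.

Lemma grid_uncircled n (i j : 'I_n) :
  ~~ circled i j -> grid n i j = value n.-1 (n.-1 - i) j.
Proof. by rewrite mxE /grid_entry circledE => /negbTE->. Qed.

(** After dualizing, the bounds of [filling] give each line a threshold, its number of uncircled
    cells; uncircled entries stay at or below it. *)
Lemma grid_circled_bound n (i j : 'I_n) : circled i j ->
  [/\ n - along n i < grid n i j, n - across n j < grid n i j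
    & grid n i j <= n].
Proof.
move=> cij; rewrite grid_circled //; move: cij; rewrite circledE => cij.
have [val_bound _ _] := filling_value n.
have [? ? ?] := val_bound _ _ cij.
have := @across_bound n j (ltn_ord j); have := @along_bound n i (ltn_ord i).
by split; lia.
Qed.

Lemma grid_uncircled_bound n (i j : 'I_n) : ~~ circled i j ->
  [/\ grid n i j <= n - along n i, grid n i j <= n - across n j
    & 0 < grid n i j].
Proof.
move=> cij; rewrite grid_uncircled //; move: cij; rewrite uncircledE => cij.
have [val_bound _ _] := filling_value n.-1.
have [? ? ?] := val_bound _ _ cij.
have := @along_complement n i (ltn_ord i).
have := @across_complement n j (ltn_ord j).
by split; lia.
Qed.

Lemma value_grid n (i j : 'I_n) :
  circled i j -> value n j i = n.+1 - grid n i j.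
Proof.
move=> cij; have := grid_circled_bound cij.
by rewrite grid_circled //; case; lia.
Qed.

Lemma grid_lt_row n (i j j' : 'I_n) :
  circled i j -> ~~ circled i j' -> grid n i j' < grid n i j.
Proof.
by move=> /grid_circled_bound[? _ _] /grid_uncircled_bound[? _ _]; lia.
Qed.

Lemma grid_lt_col n (i i' j : 'I_n) :
  circled i j -> ~~ circled i' j -> grid n i' j < grid n i j.
Proof.
by move=> /grid_circled_bound[_ ? _] /grid_uncircled_bound[_ ? _]; lia.
Qed.

(** Within one spiral distinctness comes from [filling_value]; the threshold separates a circled
    from an uncircled cell of the same line. *)
Lemma grid_latin n : latin_square (grid n).
Proof.
have [_ inj_u inj_v] := filling_value n.
have [_ inj_u' inj_v'] := filling_value n.-1.
split=> [i j|i j j' /= eq_ij|j i i' /= eq_ij].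
- have [/grid_circled_bound|/grid_uncircled_bound] := boolP (circled i j).
    by case; lia.
  by case; lia.
- have [cij|cij] := boolP (circled i j);
    have [cij'|cij'] := boolP (circled i j').
  + move: (cij) (cij'); rewrite !circledE => uv uv'.
    by apply/val_inj/(inj_v _ _ _ uv uv'); rewrite !value_grid // eq_ij.
  + by have := grid_lt_row cij cij'; rewrite eq_ij ltnn.
  + by have := grid_lt_row cij' cij; rewrite eq_ij ltnn.
  move: eq_ij (cij) (cij'); rewrite !grid_uncircled // !uncircledE.
  move=> eq_ij uv uv'.
  exact/val_inj/(inj_u' _ _ _ uv uv').
- have [cij|cij] := boolP (circled i j);
    have [cij'|cij'] := boolP (circled i' j).
  + move: (cij) (cij'); rewrite !circledE => uv uv'.
    by apply/val_inj/(inj_u _ _ _ uv uv'); rewrite !value_grid // eq_ij.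
  + by have := grid_lt_col cij cij'; rewrite eq_ij ltnn.
  + by have := grid_lt_col cij' cij; rewrite eq_ij ltnn.
  move: eq_ij (cij) (cij'); rewrite !grid_uncircled // !uncircledE.
  move=> eq_ij uv uv'.
  have := inj_v' _ _ _ uv uv' eq_ij.
  have := ltn_ord i; have := ltn_ord i'.
  by move=> ? ? ?; apply: val_inj => /=; lia.
Qed.

Lemma grid_solution n : pulsar_solution (grid n).
Proof.
split=> [|d [i [j [cij dE]]]]; first exact: grid_latin.
have [? _ ?] := grid_circled_bound cij.
have -> : [set p : 'I_n * 'I_n | circled p.1 p.2 && (grid n p.1 p.2 == d)] =
    [set p : 'I_n * 'I_n | circled p.1 p.2 &&
       (fun q => value n q.1 q.2 == n.+1 - d) (val p.2, val p.1)].
  apply/setP=> p; rewrite !inE; apply: andb_id2l => cp /=.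
  rewrite value_grid //; have [? _ ?] := grid_circled_bound cp.
  by apply/eqP/eqP; lia.
rewrite (@card_circled n (fun q => value n q.1 q.2 == n.+1 - d)).
by have := @count_values n (n.+1 - d); rewrite /values count_map => ->; lia.
Qed.

(** * Uniqueness of the solution *)

Lemma perm_ord_iota n (c : nat -> nat) (s : seq nat) :
  perm_eq [seq c u | u <- iota 0 n] s ->
  perm_eq [seq c i | i <- map val (enum 'I_n)] s.
Proof. by rewrite val_enum_ord. Qed.

(** Each digit has its exact count by [pulsar_count], so the sum is the same for all solutions; it
    feeds [row_dominance] for rows and for columns. *)
Lemma solution_sum n (L : 'M[nat]_n) : pulsar_solution L ->
  \sum_i \sum_(j | circled i j) (n.+1 - L i j) =
  \sum_(1 <= d < n.+1) (n.+1 - d) * d.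
Proof.
move=> L_sol; have [[L_bound _ _] _] := L_sol.
rewrite pair_big_dep (sum_circled (subn n.+1) L_bound) /=.
rewrite [RHS](_ : _ = \sum_(d < n.+1) (n.+1 - d) * d); last first.
  rewrite -(big_mkord xpredT (fun d => (n.+1 - d) * d)).
  by rewrite [RHS]big_ltn // muln0.
by apply: eq_bigr => d _; rewrite [LHS]mulnC pulsar_count // -ltnS.
Qed.

Lemma solution_circled_row n (L : 'M[nat]_n) (i j : 'I_n) :
  pulsar_solution L -> circled i j = (n.+1 - L i j <= along n i).
Proof.
move=> L_sol; have [[L_bound inj_row _] _] := L_sol; symmetry.
apply: (row_dominance (c := @circled n) (w := fun i j => n.+1 - L i j)
  (r := fun i => along n i)).
- by move=> {}i {}j; have := L_bound i j; lia.
- move=> {}i {j} j j' eq_L.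
  by apply: (inj_row i); have := L_bound i j; have := L_bound i j'; lia.
- exact: card_circled_row.
- by rewrite (map_comp (along n) val) perm_ord_iota // perm_along.
exact: solution_sum L_sol.
Qed.

Lemma solution_circled_col n (L : 'M[nat]_n) (i j : 'I_n) :
  pulsar_solution L -> circled i j = (n.+1 - L i j <= across n j).
Proof.
move=> L_sol; have [[L_bound _ inj_col] _] := L_sol; symmetry.
apply: (row_dominance (c := fun j i => circled i j)
  (w := fun j i => n.+1 - L i j) (r := fun j => across n j)).
- by move=> {}i {}j; have := L_bound j i; lia.
- move=> {}j {i} i i' eq_L.
  by apply: (inj_col j); have := L_bound i j; have := L_bound i' j; lia.
- exact: card_circled_col.
- by rewrite (map_comp (across n) val) perm_ord_iota // perm_across.
by rewrite -(solution_sum L_sol) [RHS](exchange_big_dep xpredT).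
Qed.

Lemma solution_eq n (L : 'M[nat]_n) : pulsar_solution L -> L = grid n.
Proof.
move=> L_sol; have [[L_bound inj_row inj_col] _] := L_sol.
have rowE i j := solution_circled_row i j L_sol.
have colE i j := solution_circled_col i j L_sol.
(* Fillings are functions on [nat], so [L] is extended by 0 outside the grid. *)
pose entry i j := if insub i is Some i' then
  if insub j is Some j' then L i' j' else 0 else 0.
have entryE (i j : 'I_n) : entry i j = L i j by rewrite /entry !valK.
have circ : filling n (fun u v => n.+1 - entry v u).
  split=> [u v|u v v'|u u' v] uv.
  - have [ltu ltv] := cells_bound uv.
    rewrite (entryE (Ordinal ltv) (Ordinal ltu)).
    have := uv; rewrite -(circledE (Ordinal ltv) (Ordinal ltu)) => cvu.
    rewrite -(rowE (Ordinal ltv)) -(colE _ (Ordinal ltu)) cvu.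
    by split=> //; have := L_bound (Ordinal ltv) (Ordinal ltu); lia.
  - move=> uv'; have [ltu ltv] := cells_bound uv.
    have [_ ltv'] := cells_bound uv'.
    rewrite (entryE (Ordinal ltv) (Ordinal ltu)).
    rewrite (entryE (Ordinal ltv') (Ordinal ltu)) => eq_L.
    apply: (congr1 val (inj_col (Ordinal ltu) (Ordinal ltv) (Ordinal ltv') _)).
    have := L_bound (Ordinal ltv) (Ordinal ltu).
    by have := L_bound (Ordinal ltv') (Ordinal ltu); lia.
  move=> u'v; have [ltu ltv] := cells_bound uv.
  have [ltu' _] := cells_bound u'v.
  rewrite (entryE (Ordinal ltv) (Ordinal ltu)).
  rewrite (entryE (Ordinal ltv) (Ordinal ltu')) => eq_L.
  apply: (congr1 val (inj_row (Ordinal ltv) (Ordinal ltu) (Ordinal ltu') _)).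
  have := L_bound (Ordinal ltv) (Ordinal ltu).
  by have := L_bound (Ordinal ltv) (Ordinal ltu'); lia.
have rev_lt u : u < n.-1 -> n.-1 - u < n by lia.
have unc : filling n.-1 (fun u v => entry (n.-1 - u) v).
  split=> [u v|u v v'|u u' v] uv.
  - have [ltu ltv] := cells_bound uv; have ltv' : v < n by lia.
    pose i := Ordinal (rev_lt u ltu); pose j := Ordinal ltv'.
    rewrite (entryE i j).
    have cij : ~~ circled i j by rewrite uncircledE /= subKn // ltnW.
    (* An uncircled cell fails both dominance bounds, so its entry is at most the number of
       uncircled cells of its row and of its column. *)
    move: (cij) (cij); rewrite {1}rowE colE.
    have := along_complement (ltn_ord i); have := across_complement (ltn_ord j).
    rewrite /= subKn; last exact: ltnW.
    by have := L_bound i j; split; lia.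
  - move=> uv'; have [ltu ltv] := cells_bound uv.
    have [_ ltv'] := cells_bound uv'.
    have ltvn : v < n by lia.
    have ltvn' : v' < n by lia.
    pose i := Ordinal (rev_lt u ltu).
    rewrite (entryE i (Ordinal ltvn)) (entryE i (Ordinal ltvn')).
    by move/inj_row/(congr1 val).
  move=> u'v; have [ltu ltv] := cells_bound uv.
  have [ltu' _] := cells_bound u'v.
  have ltvn : v < n by lia.
  rewrite (entryE (Ordinal (rev_lt u ltu)) (Ordinal ltvn)).
  rewrite (entryE (Ordinal (rev_lt u' ltu')) (Ordinal ltvn)).
  by move/inj_col/(congr1 val) => /=; lia.
apply/matrixP=> i j; have [cij|cij] := boolP (circled i j).
  rewrite grid_circled // -(filling_uniq circ) -?circledE // entryE subKn //.
  by have := L_bound i j; lia.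
rewrite grid_uncircled // -(filling_uniq unc) -?uncircledE // subKn ?entryE //.
by have := ltn_ord i; lia.
Qed.

(** * Reading the spirals from the center *)

Lemma size_cells_div k : size (cells k) = (k * k.+1) %/ 2.
Proof.
by rewrite size_cells -(big_mkord xpredT id) bin2_sum bin2 divn2 mulnC.
Qed.

(** The cell is found before the embedding [f] is chosen, so both spirals can be read off in the
    same way. *)
Lemma nth_rev_cells n k : 0 < k <= size (cells n) ->
  exists u v, [/\ (u, v) \in cells n, value n u v = pulsar k
    & forall f : nat * nat -> cell,
        nth (0, 0) (rev (map f (cells n))) k.-1 = f (u, v)].
Proof.
move=> /andP[k_gt0 le_k]; have lt_k : k.-1 < size (rev (cells n)).
  by rewrite size_rev prednK.
case E: (nth (0, 0) (rev (cells n)) k.-1) => [u v]; exists u, v; split.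
- by rewrite -E -mem_rev mem_nth.
- rewrite -[in RHS](prednK k_gt0) -(@nth_rev_values n) /values.
    by rewrite -map_rev (nth_map (0, 0)) // E.
  by rewrite size_map prednK.
by move=> f; rewrite -map_rev (nth_map (0, 0)) // E.
Qed.

Theorem theorem1 :
  exists x : nat -> nat,
    pulsar_blocks x /\
    forall n : nat, 0 < n ->
      (exists! L : 'M[nat]_n, pulsar_solution L) /\
      forall L : 'M[nat]_n, pulsar_solution L ->
        [/\ forall k, 1 <= k <= (n * n.+1) %/ 2 ->
              contains L (kth_from_center (circled_spiral n) k) (dual n (x k)),
            forall k, 1 <= k <= (n * n.-1) %/ 2 ->
              contains L (kth_from_center (uncircled_spiral n) k) (x k)
          & (forall i j j' : 'I_n, circled i j -> ~~ circled i j' ->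
               L i j' < L i j) /\
            (forall i i' j : 'I_n, circled i j -> ~~ circled i' j ->
               L i' j < L i j)].
Proof.
exists pulsar; split=> [|n n_gt0]; first exact: pulsar_blocks_pulsar.
split=> [|_ /solution_eq->].
  by exists (grid n); split=> [|L /solution_eq]; first exact: grid_solution.
have lt_grid := conj (@grid_lt_row n) (@grid_lt_col n).
split=> // k le_k.
- rewrite -size_cells_div in le_k.
  have [u [v [uv <- nthE]]] := nth_rev_cells le_k.
  have [ltu ltv] := cells_bound uv; exists (Ordinal ltv), (Ordinal ltu).
  rewrite grid_circled ?circledE // /kth_from_center /circled_spiral.
  by rewrite spiral_cells ?nthE.
have le_k' : 0 < k <= size (cells n.-1).
  by rewrite size_cells_div prednK // mulnC.
have [u [v [uv <- nthE]]] := nth_rev_cells le_k'.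
have [ltu ltv] := cells_bound uv.
have lti : n.-1 - u < n by lia.
have ltj : v < n by lia.
exists (Ordinal lti), (Ordinal ltj).
have uvE : n.-1 - (n.-1 - u) = u by lia.
rewrite grid_uncircled ?uncircledE /= uvE //; split=> //.
rewrite /kth_from_center /uncircled_spiral spiral_cells ?nthE /=; last by lia.
by congr (_, _) => /=; lia.
Qed.
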